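(* If $n\ge4$, then $$a(n)=2a(n-2)+a(n-3)-a(n-4),$$ with $a(0)=a(1)=a(2)=1$ and $a(3)=3$.
   Context: A composition of a positive integer $n$ is a sequence $\sigma_1\sigma_2\cdots\sigma_d$ of positive integers (parts) with sum $n$; there is by convention a single composition of $0$, having zero parts. A composition is parity-alternating if there is no index $1\le i\le d-1$ with $\sigma_{i+1}\equiv\sigma_i\pmod2$. For $n\ge0$, $a(n)$ denotes the number of parity-alternating compositions of $n$ (with any number of parts). *)

(* Defs.v *)
From mathcomp Require Import all_boot all_order all_algebra.

Set Implicit Arguments.
Unset Strict Implicit.
Unset Printing Implicit Defensive.

Definition is_composition (n : nat) (s : seq nat) : bool :=
  all (fun x => 0 < x) s && (sumn s == n).

(* Parts are indexed from 0, so the positions i having a successor are those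
   below d - 1, where d = size s is the number of parts; there are none when
   d <= 1. *)
Definition parity_alternating (s : seq nat) : bool :=
  ~~ [exists i : 'I_(size s).-1, nth 0 s i.+1 == nth 0 s i %[mod 2]].

(* A composition of n has at most n parts, each at most n, so the compositions
   of n live in the finite type of sequences of length at most n over 'I_n.+1;
   see pac_setP. *)
Definition pac_set (n : nat) : {set n.-bseq 'I_n.+1} :=
  [set t : n.-bseq 'I_n.+1 |
     is_composition n (map val t) && parity_alternating (map val t)].

Definition a (n : nat) : nat := #|pac_set n|.

Lemma pac_setP (n : nat) (s : seq nat) :
  (is_composition n s && parity_alternating s) <->
  (exists2 t : n.-bseq 'I_n.+1, t \in pac_set n & map val t = s).
Proof.
split=> [Hs|[t]]; last by rewrite inE => Ht <-.
have /andP[/andP[s_gt0 /eqP sum_s] _] := Hs.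
have size_s : size s <= n.
  rewrite -sum_s; elim: s s_gt0 {Hs sum_s} => //= x s IHs /andP[x_gt0 /IHs].
  by rewrite -(add1n (size s)); apply: leq_add.
have le_s : all (fun x => x < n.+1) s.
  rewrite -sum_s; apply/allP; elim: s {Hs s_gt0 sum_s size_s} => //= x s IHs y.
  rewrite inE => /predU1P[->|/IHs]; first by rewrite ltnS leq_addr.
  by rewrite !ltnS => /leq_trans; apply; apply: leq_addl.
pose u : seq 'I_n.+1 := map inord s.
have val_u : map val u = s.
  by rewrite -map_comp map_id_in // => x /(allP le_s) /inordK.
have size_u : size u <= n by rewrite size_map.
by exists (Bseq size_u); rewrite ?inE /= val_u.
Qed.

(* Main.v *)
(* Let o(n) and e(n) count the parity-alternating compositions of n with an odd,
   respectively even, first part.  Subtracting 2 from a first part >= 3, and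
   deleting a first part 1 or 2, gives o(n+2) = o(n) + e(n+1) and
   e(n+2) = e(n) + o(n) + [n = 0] = a(n).  Hence
   a(n+4) = o(n+4) + e(n+4) = o(n+2) + e(n+3) + a(n+2)
          = (a(n+2) - a(n)) + a(n+1) + a(n+2). *)
Require Import Defs.
From mathcomp Require Import all_boot all_order all_algebra zify.

Set Implicit Arguments.
Unset Strict Implicit.
Unset Printing Implicit Defensive.

Import GRing.Theory Num.Theory.
Local Open Scope ring_scope.

Definition parity_differs (x y : nat) : bool := odd x != odd y.

(** The recursive form lets a first part be peeled off, which the indexed quantifier does not. *)
Lemma parity_alternatingE (s : seq nat) :
  parity_alternating s = sorted parity_differs s.
Proof.
apply/idP/(sortedP 0%N) => [/existsPn alt_s i lt_i|alt_s].
  have lt_i' : (i < (size s).-1)%N by lia.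
  have := alt_s (Ordinal lt_i'); rewrite /= /parity_differs !modn2.
  by case: (odd _); case: (odd _).
apply/existsPn => i; have lt_i : (i.+1 < size s)%N by have := ltn_ord i; lia.
have := alt_s i lt_i; rewrite /parity_differs !modn2.
by case: (odd _); case: (odd _).
Qed.

(** The empty composition has no first part, so it lies in neither class. *)
Definition pac_from (b : bool) (n : nat) (s : seq nat) : bool :=
  if s is x :: s' then
    [&& odd x == b, is_composition n s & path parity_differs x s']
  else false.

(** Undoes the subtraction of 2 from a first part; the parity of the head, hence alternation, is
    kept. Fixing [[::]] makes the map injective on all sequences. *)
Definition add2_head (s : seq nat) : seq nat :=
  if s is x :: s' then x.+2 :: s' else [::].

Lemma add2_head_inj : injective add2_head.
Proof. by move=> [|x s] [|y t] //= [-> ->]. Qed.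

(** Explicit lists following the recursions for o and e, so that these become identities between
    sizes. The [nseq] supplies the empty tail, needed only for the composition 2 of 2. *)
Fixpoint pac_from_enum (n : nat) (b : bool) : seq (seq nat) :=
  match n with
  | 0 => [::]
  | n1.+1 => match n1 with
    | 0 => if b then [:: [:: 1%N]] else [::]
    | n2.+1 =>
      (if b then map (cons 1%N) (pac_from_enum n1 false)
       else map (cons 2) (nseq (n2 == 0%N) [::] ++ pac_from_enum n2 true))
      ++ map add2_head (pac_from_enum n2 b)
    end
  end.

Lemma mem_map_cons (x y : nat) (s : seq nat) (L : seq (seq nat)) :
  (x :: s \in map (cons y) L) = (x == y) && (s \in L).
Proof.
apply/mapP/andP => [[t Lt [-> ->]]|[/eqP-> Ls]] //.
by exists s.
Qed.

Lemma nil_map_cons (y : nat) (L : seq (seq nat)) :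
  ([::] \in map (cons y) L) = false.
Proof. by apply/mapP => -[]. Qed.

Lemma mem_map_add2_head (s : seq nat) (L : seq (seq nat)) :
  (s \in map add2_head L) =
  match s with
  | [::] => [::] \in L
  | x :: s' => (1 < x)%N && ((x - 2)%N :: s' \in L)
  end.
Proof.
case: s => [|[|[|x]] s].
- exact: (mem_map add2_head_inj L [::]).
- by apply/mapP => -[[]].
- by apply/mapP => -[[]].
- by rewrite !subSS subn0 /=; exact: (mem_map add2_head_inj L (x :: s)).
Qed.

Lemma uniq_nseq_bool (T : eqType) (k : bool) (x : T) : uniq (nseq k x).
Proof. by case: k. Qed.

Lemma mem_nseq_nil (k : bool) (s : seq nat) :
  (s \in nseq k [::]) = k && nilp s.
Proof. by case: k; case: s. Qed.

Lemma mem_pac_from_enum (n : nat) (b : bool) (s : seq nat) :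
  (s \in pac_from_enum n b) = pac_from b n s.
Proof.
elim/ltn_ind: n b s => -[|[|n]] IHn b s.
- by case: s => [|[|x] s] //=; rewrite /is_composition /= ?andbF.
- case: b s => -[|[|[|x]] [|[|y] s]] //=;
    by rewrite /is_composition /= ?(andbF, inE).
have IH0 := IHn n (leqnSn _); have IH1 := IHn n.+1 (leqnn _).
rewrite [pac_from_enum _ _]/= -/(pac_from_enum n.+1 false) mem_cat.
rewrite mem_map_add2_head.
case: s => [|x s]; first by case: b; rewrite nil_map_cons !IH0.
case: b; rewrite mem_map_cons ?mem_cat ?mem_nseq_nil ?IH0 ?IH1.
  case: x => [|[|x]] //=; last first.
    rewrite !subSS subn0 negbK /is_composition /=.
    case: x => [|x] //=; rewrite !addSn !eqSS; congr [&& _, _ & _].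
    by case: s => //= y s; rewrite /parity_differs /= negbK.
  rewrite orbF /is_composition /= add1n eqSS.
  (* Alternation between the deleted 1 and [y] says that [y] is even, which is the parity demanded
     of the tail. *)
  case: s => [|y s] //=; rewrite /is_composition /= {2}/parity_differs /=.
  by case: (odd y); rewrite /= ?andbF ?andbT.
case: x => [|[|[|x]]] //=; last first.
  rewrite !subSS subn0 negbK /is_composition /=.
  rewrite !addSn !eqSS; congr [&& _, _ & _].
  by case: s => //= y s; rewrite /parity_differs /= negbK.
rewrite /is_composition /= orbF !addSn add0n !eqSS.
case: s => [|y s] //=; first by rewrite andbT orbF eq_sym andbT.
rewrite andbF /= /is_composition /= {2}/parity_differs /=.
by case: (odd y); rewrite /= ?andbF ?andbT.
Qed.

Lemma uniq_pac_from_enum (n : nat) (b : bool) : uniq (pac_from_enum n b).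
Proof.
elim/ltn_ind: n b => -[|[|n]] IHn b //; first by case: b.
have IH0 := IHn n (leqnSn _); have IH1 := IHn n.+1 (leqnn _).
rewrite [pac_from_enum _ _]/= -/(pac_from_enum n.+1 false).
have cons_inj (x : nat) : injective (cons x) by move=> s t [].
rewrite cat_uniq (map_inj_uniq add2_head_inj) IH0 andbT; apply/andP; split.
  case: b; rewrite (map_inj_uniq (@cons_inj _)) // cat_uniq uniq_nseq_bool IH0 andbT.
  apply/hasPn => s; rewrite mem_nseq_nil mem_pac_from_enum.
  by case: s => [|x s]; rewrite ?andbF.
(* The two sublists are disjoint: raising a positive head by 2 gives at least 3, while the prepended
   heads are 1 or 2. *)
apply/hasPn => _ /mapP[s + ->]; rewrite mem_pac_from_enum.
case: s => [|x s] //= /and3P[_ /andP[/andP[x_gt0 _] _] _].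
by case: b; rewrite mem_map_cons // !eqSS; case: x x_gt0.
Qed.

(** Passes from the finite type to plain lists: [map val] is injective, and [pac_setP] identifies
    its image. *)
Lemma a_size (n : nat) (L : seq (seq nat)) : uniq L ->
    (forall s, (s \in L) = is_composition n s && parity_alternating s) ->
  a n = size L.
Proof.
move=> uniq_L mem_L; pose f (t : n.-bseq 'I_n.+1) : seq nat := map val t.
have f_inj : injective f.
  by move=> t u /(inj_map val_inj) eq_tu; apply: val_inj.
rewrite /a cardE -(size_map f); apply/perm_size/uniq_perm => //.
  by rewrite (map_inj_uniq f_inj) enum_uniq.
move=> s; rewrite mem_L; apply/mapP/idP => [[t + ->]|/pac_setP[t t_n <-]].
  by rewrite mem_enum inE.
by exists t; rewrite ?mem_enum.
Qed.

Definition num_pac_from (b : bool) (n : nat) : nat := size (pac_from_enum n b).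

(** The term [n == 0] accounts for the empty composition. *)
Lemma a_parity_split (n : nat) :
  a n = ((n == 0) + (num_pac_from true n + num_pac_from false n))%N.
Proof.
rewrite (@a_size n (nseq (n == 0)%N [::]
                    ++ pac_from_enum n true ++ pac_from_enum n false)).
- by rewrite !size_cat size_nseq.
- rewrite !cat_uniq uniq_nseq_bool !uniq_pac_from_enum andbT /=.
  apply/andP; split; apply/hasPn => s.
    rewrite mem_cat mem_nseq_nil !mem_pac_from_enum.
    by case: s => [|x s]; rewrite ?andbF.
  rewrite !mem_pac_from_enum; case: s => [|x s] //=.
  by case: (odd x).
move=> s; rewrite !mem_cat mem_nseq_nil !mem_pac_from_enum.
rewrite parity_alternatingE; case: s => [|x s] /=.
  by rewrite /is_composition /= !orbF !andbT eq_sym.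
by case: (odd x); rewrite andbF /= ?orbF.
Qed.

Lemma num_pac_from_odd (n : nat) :
  num_pac_from true n.+2 = (num_pac_from false n.+1 + num_pac_from true n)%N.
Proof. by rewrite /num_pac_from [pac_from_enum n.+2 _]/= size_cat !size_map. Qed.

Lemma num_pac_from_even (n : nat) : num_pac_from false n.+2 = a n.
Proof.
by rewrite a_parity_split /num_pac_from /= !(size_cat, size_map) size_nseq addnA.
Qed.

Theorem proposition7 :
  (forall n : nat, (4 <= n)%N ->
     (a n)%:Z = 2 * (a (n - 2)%N)%:Z + (a (n - 3)%N)%:Z - (a (n - 4)%N)%:Z)
  /\ [/\ a 0 = 1%N, a 1 = 1%N, a 2 = 1%N & a 3 = 3%N].
Proof.
(* The split turns the initial values into sizes of explicit lists, which compute. *)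
split; last by split; rewrite a_parity_split.
move=> [|[|[|[|n]]]] // _; rewrite !subSS !subn0.
(* The split at [n.+2] serves to eliminate the odd count left over from the split at [n.+4]; what
   remains is linear. *)
have := a_parity_split n.+4; have := a_parity_split n.+2.
rewrite !num_pac_from_even (num_pac_from_odd n.+2) num_pac_from_even /=.
lia.
Qed.
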